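(* (a) The set of pairs $(z,d)\in\omega^\omega\times\mathbb{R}^{\omega\times\omega}$ such that $d$ is a metric on $\omega$ and $z$ is a Cauchy sequence in $\langle\omega,d\rangle$ is $\boldsymbol{\Pi}^0_3$. (b) The set of triples $(g,d,d')\in\omega^\omega\times(\mathbb{R}^{\omega\times\omega})^2$ such that $d,d'$ are metrics on $\omega$ and $g:\langle\omega,d\rangle\to\langle\omega,d'\rangle$ is continuous is $\boldsymbol{\Pi}^0_3$. (c) $\mathcal{C}(\omega)$ is $\boldsymbol{\Pi}^1_1$ in $\omega^\omega\times(\mathbb{R}^{\omega\times\omega})^2$. (d) The relation $\preceq_{\mathrm{cdi}}$ on $\mathcal{C}(\omega)$, viewed as a subset of $(\omega^\omega)^2\times(\mathbb{R}^{\omega\times\omega})^4$, is the intersection of a $\boldsymbol{\Sigma}^1_1$ set and a $\boldsymbol{\Pi}^1_1$ set. (e) The relation $\approx_{\mathrm{cdi}}$ on $\mathcal{C}(\omega)$, viewed as a subset of $(\omega^\omega)^2\times(\mathbb{R}^{\omega\times\omega})^4$, is the intersection of a $\boldsymbol{\Sigma}^1_1$ set and a $\boldsymbol{\Pi}^1_1$ set.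
   Context: Metrics on $\omega$ are viewed as elements of $\mathbb{R}^{\omega\times\omega}$; functions $\omega\to\omega$ and sequences in $\omega$ are elements of $\omega^\omega$. A dense isometry is a distance-preserving map (not necessarily onto) with dense image. A function between metric spaces is Cauchy-continuous if it maps Cauchy sequences to Cauchy sequences. $\mathcal{C}(\omega)$ is the set of triples $(g,d,d')$ where $d,d'$ are metrics on $\omega$ and $g:\langle\omega,d\rangle\to\langle\omega,d'\rangle$ is Cauchy-continuous. On $\mathcal{C}(\omega)$: $(g_0,d_0,d'_0)\preceq_{\mathrm{cdi}}(g_1,d_1,d'_1)$ iff there are dense isometries $\iota:\langle\omega,d_0\rangle\to\langle\omega,d_1\rangle$ and $\iota':\langle\omega,d'_0\rangle\to\langle\omega,d'_1\rangle$ with $\iota'\circ g_0=g_1\circ\iota$; and $(g_0,d_0,d'_0)\approx_{\mathrm{cdi}}(g_1,d_1,d'_1)$ iff there is $(g,d,d')\in\mathcal{C}(\omega)$ with $(g_e,d_e,d'_e)\preceq_{\mathrm{cdi}}(g,d,d')$ for each $e\in\{0,1\}$. *)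

(* Defs.v *)
From HB Require Import structures.
From mathcomp Require Import all_boot all_order all_algebra.
From mathcomp Require Import all_classical all_reals all_analysis.
Set Implicit Arguments. Unset Strict Implicit. Unset Printing Implicit Defensive.
Import Order.TTheory GRing.Theory Num.Theory.
Import numFieldNormedType.Exports.
Local Open Scope classical_set_scope.
Local Open Scope ring_scope.

Notation BaireSp := {ptws nat -> nat}.
Notation RMat R := {ptws (nat * nat)%type -> R}.

(** Boldface Borel classes, indexed from 1:
    Sigma0 1 = open sets, Pi0 n = complements of Sigma0 n,
    Sigma0 (n+1) = countable unions of Pi0 n sets. *)
Fixpoint Sigma0 {X : topologicalType} (n : nat) (A : set X) : Prop :=
  match n with
  | 0 => False
  | k.+1 =>
      if k is 0 then open A
      else exists F : (set X)^nat,
             (forall i, Sigma0 k (~` F i)) /\ A = \bigcup_i F i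
  end.

Definition Pi0 {X : topologicalType} (n : nat) (A : set X) : Prop :=
  Sigma0 n (~` A).

(** Boldface Sigma^1_1 (analytic) sets of a Polish space X: projections of
    closed subsets of X x omega^omega.  Pi^1_1 = complements of those. *)
Definition Sigma11 {X : topologicalType} (A : set X) : Prop :=
  exists F : set (X * BaireSp)%type, closed F /\ A = fst @` F.

Definition Pi11 {X : topologicalType} (A : set X) : Prop :=
  Sigma11 (~` A).

Section MetricNotions.
Context {R : realType}.

Definition is_metric (d : (nat * nat)%type -> R) : Prop :=
  (forall x y, 0 <= d (x, y)) /\
  (forall x y, d (x, y) = 0 <-> x = y) /\
  (forall x y, d (x, y) = d (y, x)) /\
  (forall x y z, d (x, z) <= d (x, y) + d (y, z)).

Definition cauchy_seq (d : (nat * nat)%type -> R) (z : nat -> nat) : Prop :=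
  forall eps : R, 0 < eps ->
    exists N : nat, forall m n : nat, (N <= m)%N -> (N <= n)%N ->
      d (z m, z n) < eps.

Definition metric_continuous (d d' : (nat * nat)%type -> R) (g : nat -> nat)
  : Prop :=
  forall x : nat, forall eps : R, 0 < eps ->
    exists2 delta : R, 0 < delta &
      forall y : nat, d (x, y) < delta -> d' (g x, g y) < eps.

Definition cauchy_continuous (d d' : (nat * nat)%type -> R) (g : nat -> nat)
  : Prop :=
  forall z : nat -> nat, cauchy_seq d z -> cauchy_seq d' (g \o z).

Definition dense_isometry (d0 d1 : (nat * nat)%type -> R) (iota : nat -> nat)
  : Prop :=
  (forall x y, d1 (iota x, iota y) = d0 (x, y)) /\
  (forall y : nat, forall eps : R, 0 < eps -> exists x, d1 (iota x, y) < eps).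

Definition Comega (g : nat -> nat) (d d' : (nat * nat)%type -> R) : Prop :=
  is_metric d /\ is_metric d' /\ cauchy_continuous d d' g.

Definition cdi_le (g0 : nat -> nat) (d0 d0' : (nat * nat)%type -> R)
                  (g1 : nat -> nat) (d1 d1' : (nat * nat)%type -> R) : Prop :=
  exists iota iota' : nat -> nat,
    [/\ dense_isometry d0 d1 iota, dense_isometry d0' d1' iota'
      & iota' \o g0 = g1 \o iota].

Definition cdi_equiv (g0 : nat -> nat) (d0 d0' : (nat * nat)%type -> R)
                     (g1 : nat -> nat) (d1 d1' : (nat * nat)%type -> R) : Prop :=
  exists g : nat -> nat, exists d d' : (nat * nat)%type -> R,
    [/\ Comega g d d', cdi_le g0 d0 d0' g d d' & cdi_le g1 d1 d1' g d d'].

End MetricNotions.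

(* Main.v *)
(** The Sigma^1_1 sets are closed under countable unions and intersections,
    continuous preimages and projections along omega^omega; they are also
    closed under projections along R^(omega x omega), a continuous image of
    omega^omega.  Since metrics and Cauchy sequences are defined by countably
    many inequalities, this gives all the bounds except the one on
    approx_cdi, which quantifies over a Cauchy-continuous [g] and would only be
    Sigma^1_2.  There, once [g0] is Cauchy-continuous and maps by dense
    isometries into [g], continuity of [g] already implies its
    Cauchy-continuity: a Cauchy sequence can be approximated by one in the dense
    range of [iota], closely enough that the values of [g] are close as well.
    Replacing Cauchy-continuity by continuity, a Pi^0_3 condition, leaves a
    Sigma^1_1 condition. *)
Require Import Defs.
From HB Require Import structures.
From mathcomp Require Import all_boot all_order all_algebra.
From mathcomp Require Import all_classical all_reals all_analysis.
From mathcomp Require Import ring lra.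
Import Order.TTheory GRing.Theory Num.Theory.
Import numFieldNormedType.Exports.
Local Open Scope classical_set_scope.
Local Open Scope ring_scope.

(** * Continuity into function spaces and discrete spaces, and basic closed sets *)

Lemma continuous_ptws (I : Type) (X T : topologicalType) (f : X -> {ptws I -> T}) :
  (forall i, continuous (fun x => f x i)) -> continuous f.
Proof.
move=> fc x; apply/cvg_sup => i U [V [[W oW <-] Vfx] WU].
by apply: filterS WU _; apply: fc; apply: open_nbhs_nbhs; split.
Qed.

(** The index is locally constant, so near [x] the map agrees with evaluation of [h] at the fixed
    index [i x], a coordinate projection. This covers terms such as [d (z m, z n)], where the entry
    that is read depends on the point. *)
Lemma continuous_eval (I : eqType) (X T : topologicalType)
    (h : X -> {ptws I -> T}) (i : X -> I) :
  continuous h -> (forall x, \forall y \near x, i y = i x) ->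
  continuous (fun x => h x (i x)).
Proof.
move=> hc ic x U nU.
have hU : \forall y \near x, U (h y (i x)).
  by apply: (continuous_comp (hc x) (@proj_continuous _ (fun=> T) (i x) (h x))).
by apply: filterS2 (ic x) hU => y; rewrite /= => ->.
Qed.

Lemma continuous_discrete_near (X : topologicalType) (I : discreteTopologicalType)
    (i : X -> I) : continuous i -> forall x, \forall y \near x, i y = i x.
Proof. by move=> ic x; exact: (ic x _ (discrete_set1 (i x))). Qed.

Lemma continuous_eval_nat (X T : topologicalType) (h : X -> {ptws nat -> T})
    (i : X -> nat) :
  continuous h -> continuous i -> continuous (fun x => h x (i x)).
Proof.
by move=> hc ic; apply: continuous_eval hc _; exact: (@continuous_discrete_near X nat).
Qed.

Lemma continuous_eval_cst (I : eqType) (X T : topologicalType) (h : X -> {ptws I -> T})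
    (i : I) : continuous h -> continuous (fun x => h x i).
Proof. by move=> hc; apply: (continuous_eval _ _ _ h (fun=> i)) => // x; exact: nearW. Qed.

Lemma continuous_eval_nat2 (X T : topologicalType) (h : X -> {ptws (nat * nat)%type -> T})
    (i j : X -> nat) :
  continuous h -> continuous i -> continuous j -> continuous (fun x => h x (i x, j x)).
Proof.
move=> hc ic jc; apply: (@continuous_eval _ _ _ _ (fun x => (i x, j x)) hc) => x.
have ix := @continuous_discrete_near X nat i ic x.
have jx := @continuous_discrete_near X nat j jc x.
by apply: filterS2 ix jx => y -> ->.
Qed.

Lemma continuous_pair (X S T : topologicalType) (f : X -> S) (g : X -> T) :
  continuous f -> continuous g -> continuous (fun x => (f x, g x)).
Proof. by move=> fc gc x; apply: cvg_pair; [exact: fc | exact: gc]. Qed.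

Lemma continuous_fst (S T : topologicalType) : continuous (@fst S T).
Proof. by move=> x; exact: cvg_fst. Qed.

Lemma continuous_snd (S T : topologicalType) : continuous (@snd S T).
Proof. by move=> x; exact: cvg_snd. Qed.

Lemma continuous_fst_comp (X S T : topologicalType) (f : X -> (S * T)%type) :
  continuous f -> continuous (fun x => (f x).1).
Proof. by move=> fc x; apply: continuous_comp; [exact: fc | exact: cvg_fst]. Qed.

Lemma continuous_snd_comp (X S T : topologicalType) (f : X -> (S * T)%type) :
  continuous f -> continuous (fun x => (f x).2).
Proof. by move=> fc x; apply: continuous_comp; [exact: fc | exact: cvg_snd]. Qed.

Lemma continuous_constant (X T : topologicalType) (t : T) :
  continuous (fun _ : X => t).
Proof. by move=> x; exact: cvg_cst. Qed.

Lemma continuous_identity (X : topologicalType) : continuous (fun x : X => x).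
Proof. by move=> x; exact: cvg_id. Qed.

Lemma closed_preimage (X T : topologicalType) (f : X -> T) (A : set T) :
  continuous f -> closed A -> closed (f @^-1` A).
Proof. by move=> fc; apply: preimage_closed => x _; exact: fc. Qed.

(** Near a point where [a] and [b] differ, both maps are constant, so they still differ. *)
Lemma closed_eq_discrete (X : topologicalType) (I : discreteTopologicalType)
    (a b : X -> I) : continuous a -> continuous b -> closed [set x | a x = b x].
Proof.
move=> ac bc; rewrite -openC; rewrite openE => x /= ab.
have A := ac x _ (discrete_set1 (a x)); have B := bc x _ (discrete_set1 (b x)).
rewrite /interior; near=> y => /=.
have -> : a y = a x by near: y.
by have -> : b y = b x by near: y.
Unshelve. all: by end_near.
Qed.

Lemma closed_le_continuous (R : realType) (X : topologicalType) (a b : X -> R) :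
  continuous a -> continuous b -> closed [set x | a x <= b x].
Proof.
move=> ac bc.
have -> : [set x | a x <= b x] = (fun x => b x - a x) @^-1` [set y | 0 <= y].
  by apply/seteqP; split => x /=; rewrite subr_ge0.
apply: closed_preimage; last exact: closed_ge.
by move=> x; apply: (@continuousB _ R^o); [exact: bc | exact: ac].
Qed.

Lemma continuous_compose (X Y Z : topologicalType) (f : Y -> Z) (g : X -> Y) :
  continuous f -> continuous g -> continuous (fun x => f (g x)).
Proof. by move=> fc gc x; apply: continuous_comp; [exact: gc | exact: fc]. Qed.

Lemma continuous_addr (R : realType) (X : topologicalType) (a b : X -> R) :
  continuous a -> continuous b -> continuous (fun x => a x + b x).
Proof. by move=> ac bc x; apply: (@continuousD _ R^o); [exact: ac | exact: bc]. Qed.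

(* Unification does not find the product types in projections, nor nat as a
   topological space, hence the explicit arguments. *)
Ltac continuity :=
  solve [ assumption
        | exact: continuous_identity
        | move=> ?; exact: cvg_cst
        | apply: continuous_eval_nat2; continuity
        | apply: continuous_eval_cst; continuity
        | apply: (@continuous_eval_cst _ _ nat); continuity
        | apply: continuous_eval_nat; continuity
        | apply: (@continuous_eval_nat _ nat); continuity
        | apply: continuous_addr; continuity
        | apply: continuous_pair; continuity
        | exact: continuous_fst
        | exact: continuous_snd
        | lazymatch goal with
          | |- forall x, continuous_at x (fun y => @fst ?S ?T _) =>
            apply: (@continuous_fst_comp _ S T); continuity
          | |- forall x, continuous_at x (fun y => @snd ?S ?T _) =>
            apply: (@continuous_snd_comp _ S T); continuity
          end
        | match goal with H : _ |- _ => apply: (continuous_compose _ _ _ _ _ H); continuity end ].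
Lemma continuous_baire_comp (X : topologicalType) (f g : X -> BaireSp) :
  continuous f -> continuous g -> continuous (fun x => (f x \o g x) : BaireSp).
Proof.
move=> fc gc; apply: continuous_ptws => n.
by apply: (@continuous_eval_nat _ nat f (fun x => g x n)); continuity.
Qed.

(** * Closure properties of analytic sets *)

(** Splits one point of Baire space into countably many, so that a single witness can carry a
    sequence of witnesses. *)
Definition component (w : BaireSp) (n : nat) : BaireSp := fun k => w (pickle (n, k)).

Lemma component_surj (v : nat -> BaireSp) :
  exists w : BaireSp, forall n, component w n = v n.
Proof.
(* Numbers that code no pair are never read by a component; they get the value 0. *)
exists (fun m => if unpickle m is Some (n, k) then v n k else 0%N) => n.
by apply: funext => k; rewrite /component pickleK.
Qed.

Lemma continuous_component (X : topologicalType) (w : X -> BaireSp) (n : nat) :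
  continuous w -> continuous (fun x => component (w x) n).
Proof.
move=> wc; apply: continuous_ptws => k.
by apply: continuous_eval_nat wc _; exact: (@continuous_constant X nat).
Qed.

Lemma sigma11P (X : topologicalType) (A : set X) :
  Sigma11 A <-> exists2 F : set (X * BaireSp)%type,
    closed F & forall x, A x <-> exists w, F (x, w).
Proof.
split=> [[F [cF ->]]|[F cF AF]]; exists F => //; [move=> x|].
  by split=> [[[y w] Fyw <-]|[w Fxw]]; [exists w | exists (x, w)].
split=> //; apply/seteqP; split=> [x /AF [w Fxw]|_ [[x w] Fxw <-]].
  by exists (x, w).
by apply/AF; exists w.
Qed.

Lemma sigma11_closed (X : topologicalType) (A : set X) : closed A -> Sigma11 A.
Proof.
move=> cA; apply/sigma11P; exists (fst @^-1` A).
  by apply: closed_preimage cA; exact: continuous_fst.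
by move=> x; split=> [Ax|[]//]; exists (fun=> 0%N).
Qed.

Lemma sigma11_preimage (X Y : topologicalType) (f : X -> Y) (A : set Y) :
  continuous f -> Sigma11 A -> Sigma11 (f @^-1` A).
Proof.
move=> fc /sigma11P[F cF AF]; apply/sigma11P.
exists ((fun q : X * BaireSp => (f q.1, q.2)) @^-1` F).
  apply: closed_preimage cF; apply: continuous_pair.
    move=> q; apply: continuous_comp (fc q.1); exact: cvg_fst.
  exact: continuous_snd.
by move=> x; exact: AF.
Qed.

(** The new witness stores the index [n] in entry 0 of component 0 and a witness for [P n] in
    component 1. *)
Lemma sigma11_exists (X : topologicalType) (P : nat -> X -> Prop) :
  (forall n, Sigma11 [set x | P n x]) -> Sigma11 [set x | exists n, P n x].
Proof.
move=> SP; have /choice[F PF] n : exists F : set (X * BaireSp),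
    closed F /\ forall x, P n x <-> exists w, F (x, w).
  by have /sigma11P[F cF PF] := SP n; exists F.
apply/sigma11P.
(* A union of the closed sets [F n] need not be closed. Instead each [n] demands that the stored
   index differ from [n] or that [F n] hold: an intersection of closed sets in which only the stored
   index is binding. *)
exists (\bigcap_n ([set q : X * BaireSp | component q.2 0 0 <> n] `|`
   (fun q => (q.1, component q.2 1)) @^-1` F n)).
  apply: closed_bigI => n _; apply: closedU; last apply: closed_preimage (PF n).1.
    apply: (@closed_preimage _ nat (fun q => component q.2 0 0) [set m | m <> n]).
      apply: (@continuous_eval_nat _ nat (fun q => component q.2 0) (fun=> 0%N)).
        by apply: continuous_component; exact: continuous_snd.
      exact: (@continuous_constant _ nat).
    by rewrite -openC; exact: discrete_open.
  apply: continuous_pair; first exact: continuous_fst.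
  by apply: continuous_component; exact: continuous_snd.
move=> x; split=> [[n /(PF n).2[w Fw]]|[w /(_ (component w 0 0) Logic.I)[]//= Fw]].
  have [v vE] := component_surj (fun i => if i is 0%N then fun=> n else w).
  by exists v => m _; case: (eqVneq n m) => [<-|/eqP]; [right|left]; rewrite /= !vE.
by exists (component w 0 0); apply/(PF _).2; exists (component w 1).
Qed.

(** Component [n] of the new witness serves as witness for [P n]; countable choice collects these
    witnesses. *)
Lemma sigma11_forall (X : topologicalType) (P : nat -> X -> Prop) :
  (forall n, Sigma11 [set x | P n x]) -> Sigma11 [set x | forall n, P n x].
Proof.
move=> SP; have /choice[F PF] n : exists F : set (X * BaireSp),
    closed F /\ forall x, P n x <-> exists w, F (x, w).
  by have /sigma11P[F cF PF] := SP n; exists F.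
apply/sigma11P.
exists (\bigcap_n ((fun q => (q.1, component q.2 n)) @^-1` F n)).
  apply: closed_bigI => n _; apply: closed_preimage (PF n).1.
  apply: continuous_pair; first exact: continuous_fst.
  apply: continuous_component; exact: continuous_snd.
move=> x; split=> [Px|[w Fxw] n]; last by apply/(PF n).2; exists (component w n); exact: Fxw.
have /choice[v Fv] n : exists w, F n (x, w) by apply/(PF n).2.
by have [w wv] := component_surj v; exists w => n _ /=; rewrite wv.
Qed.

(** Two witnesses merge into one: component 0 is the quantified point, component 1 the witness of
    its membership. *)
Lemma sigma11_exists_baire (X : topologicalType) (P : X -> BaireSp -> Prop) :
  Sigma11 [set q : X * BaireSp | P q.1 q.2] -> Sigma11 [set x | exists w : BaireSp, P x w].
Proof.
move=> /sigma11P[F cF PF]; apply/sigma11P.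
exists ((fun q : X * BaireSp => ((q.1, component q.2 0), component q.2 1)) @^-1` F).
  apply: closed_preimage cF.
  apply: continuous_pair; last by apply: continuous_component; exact: continuous_snd.
  apply: continuous_pair; first exact: continuous_fst.
  by apply: continuous_component; exact: continuous_snd.
move=> x; split=> [[w /(PF (x, w))[u Fu]]|[w Fw]].
  have [v vE] := component_surj (fun n => if n is 0%N then w else u).
  by exists v; rewrite /= !vE.
by exists (component w 0); apply/(PF (x, _)); exists (component w 1).
Qed.

(** * Coding reals by Baire space, and projection along the space of matrices *)

Section RealCode.
Context {R : realType}.

(* [w 0] and [w 1] code the integer part, the parities of the other entries are
   binary digits: the limit is a continuous surjection of the Baire space on R. *)
Definition dyadic_sum (w : BaireSp) (n : nat) : R :=
  (w 0)%:R - (w 1)%:R + \sum_(i < n) (odd (w i.+2))%:R / 2 ^+ i.+1.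

Lemma dyadic_sumS (w : BaireSp) (n : nat) :
  dyadic_sum w n.+1 = dyadic_sum w n + (odd (w n.+2))%:R / 2 ^+ n.+1.
Proof. by rewrite /dyadic_sum big_ord_recr addrA. Qed.

Lemma half_expS (n : nat) : (2 ^+ n)^-1 = (2 ^+ n.+1)^-1 + (2 ^+ n.+1)^-1 :> R.
Proof. by rewrite exprS invfM; field. Qed.

Lemma half_exp_gt0 (n : nat) : 0 < (2 ^+ n)^-1 :> R.
Proof. by rewrite invr_gt0 exprn_gt0. Qed.

Lemma half_exp_small (e : R) : 0 < e -> exists n, (2 ^+ n)^-1 < e.
Proof.
move=> e0; have [n _ /(_ n (leqnn n)) /= ne] := near_infty_natSinv_expn_lt (PosNum e0).
by exists n; move: ne; rewrite div1r.
Qed.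

(** Subtracting the last power of 2 makes the upper bound inductive: it grows by exactly the largest
    possible next digit. *)
Lemma dyadic_sum_mono (w : BaireSp) (n k : nat) :
  dyadic_sum w n <= dyadic_sum w (n + k) <=
  dyadic_sum w n + (2 ^+ n)^-1 - (2 ^+ (n + k))^-1.
Proof.
elim: k => [|k]; first by rewrite addn0 lexx addrK lexx.
rewrite addnS dyadic_sumS (half_expS (n + k)) => /andP[].
have := half_exp_gt0 (n + k).+1; case: odd => /= *; apply/andP; split; lra.
Qed.

Definition real_code (w : BaireSp) : R := sup (range (dyadic_sum w)).

(** The brackets that determine the limit; continuity and surjectivity of the coding both rest on
    them. *)
Lemma real_code_itv (w : BaireSp) (n : nat) :
  dyadic_sum w n <= real_code w <= dyadic_sum w n + (2 ^+ n)^-1.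
Proof.
(* The [m]-th upper bracket bounds the later partial sums by the tail estimate and the earlier ones
   by monotonicity. *)
have ub m : ubound (range (dyadic_sum w)) (dyadic_sum w m + (2 ^+ m)^-1).
  move=> _ [k _ <-]; have := half_exp_gt0 m; case: (leqP m k) => [mk|/ltnW km].
    have /andP[_] := dyadic_sum_mono w m (k - m).
    by rewrite subnKC //; have := half_exp_gt0 k; lra.
  have /andP[] := dyadic_sum_mono w k (m - k); rewrite subnKC //; lra.
apply/andP; split; last by apply: ge_sup (ub n); exists (dyadic_sum w 0), 0%N.
by apply: ub_le_sup; [exists (dyadic_sum w 0 + (2 ^+ 0)^-1) | exists n].
Qed.

Lemma real_code_unique (w : BaireSp) (r : R) :
  (forall n, dyadic_sum w n <= r <= dyadic_sum w n + (2 ^+ n)^-1) -> real_code w = r.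
Proof.
move=> wr; apply/eqP/contraT; rewrite -subr_eq0 -normr_gt0 => /half_exp_small[n].
have /andP[] := wr n; have /andP[] := real_code_itv w n.
rewrite ltr_normr => *; exfalso; lra.
Qed.

(** The [n]-th partial sum reads finitely many entries, so it is constant near [w]; both values then
    lie in one interval of length [2 ^- n]. *)
Lemma continuous_real_code : continuous real_code.
Proof.
move=> w; apply/(@cvgrPdist_lt _ R^o) => e e0; have [n ne] := half_exp_small _ e0.
have wn i : \forall v \near w, v i = w i.
  exact: (@proj_continuous nat (fun=> nat) i w _ (discrete_set1 (w i))).
have : \forall v \near w, dyadic_sum v n = dyadic_sum w n.
  elim: (n) => [|m IH].
    by apply: filterS2 (wn 0) (wn 1) => v v0 v1; rewrite /dyadic_sum !big_ord0 v0 v1.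
  by apply: filterS2 IH (wn m.+2) => v vm vm2; rewrite !dyadic_sumS vm vm2.
apply: filterS => v vw; have /andP[] := real_code_itv v n.
have /andP[] := real_code_itv w n; rewrite vw ltr_norml => *; apply/andP; split; lra.
Qed.

Lemma real_code_surj (r : R) : exists w, real_code w = r.
Proof.
(* The integer part is written as a difference of naturals, one of which is 0 according to the sign
   of the floor. *)
have [a [b /andP[ar rb]]] : exists a b : nat, (a%:R - b%:R <= r <= a%:R - b%:R + 1).
  have := floor_itv r; case: (Num.floor r) => k /andP[].
    by rewrite intrD => kr rk; exists k, 0%N; rewrite subr0; apply/andP; split; [|apply: ltW].
  rewrite NegzE intrD !mulrNz => kr rk; exists 0%N, k.+1; rewrite sub0r.
  by apply/andP; split; [|apply: ltW].
(* Greedy binary expansion: the next power is added whenever the sum stays at most [r]. In [w] the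
   outcome of that test is a boolean read as 0 or 1, whose parity is the digit. *)
pose fix S (n : nat) : R := if n is m.+1 then
  (if S m + (2 ^+ n)^-1 <= r then S m + (2 ^+ n)^-1 else S m) else a%:R - b%:R.
pose w (n : nat) : nat := match n with 0 => a | 1 => b
  | m.+2 => (S m + (2 ^+ m.+1)^-1 <= r)%R end.
have Sw n : dyadic_sum w n = S n.
  elim: n => [|n IH]; first by rewrite /dyadic_sum big_ord0 addr0.
  by rewrite dyadic_sumS IH /=; case: ifP => _ /=; rewrite ?mul1r ?mul0r ?addr0.
exists w; apply: real_code_unique => n; rewrite Sw; elim: n => [|n IH].
  by rewrite /= expr0 invr1; apply/andP.
have /andP[] := IH; rewrite /= (half_expS n); case: ifPn => [|/negP/negP];
  rewrite -?ltNge => *; apply/andP; split; lra.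
Qed.

(** Decoding entry by entry maps Baire space continuously onto the matrices, so a quantifier over
    matrices becomes one over Baire space. *)
Lemma sigma11_exists_matrix (X : topologicalType) (P : X -> RMat R -> Prop) :
  Sigma11 [set q : X * RMat R | P q.1 q.2] ->
  Sigma11 [set x | exists d : RMat R, P x d].
Proof.
pose f (w : BaireSp) : RMat R := fun ij => real_code (component w (pickle ij)).
have fc : continuous f.
  apply: continuous_ptws => ij w; apply: continuous_comp; last exact: continuous_real_code.
  by apply: continuous_component; exact: continuous_identity.
move=> SP; have -> : [set x | exists d : RMat R, P x d] =
    [set x | exists w : BaireSp, P x (f w)].
  apply/seteqP; split=> x [d Pd]; last by exists (f d).
  (* A code is chosen for every number; those that code no pair of indices receive a code of the
     real 0. *)
  have /choice[v vE] n : exists v : BaireSp,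
      real_code v = if unpickle n is Some ij then d ij else 0.
    exact: real_code_surj.
  have [w wE] := component_surj v; exists w.
  by congr (P x _): Pd; apply: funext => ij; rewrite /f wE vE pickleK.
apply: sigma11_exists_baire.
apply: (sigma11_preimage _ _ (fun q : X * BaireSp => (q.1, f q.2))) SP.
apply: continuous_pair; first exact: continuous_fst.
by move=> q; apply: continuous_comp; [exact: continuous_snd | exact: fc].
Qed.

End RealCode.

(** * Finite combinations of analytic sets, and the class [Pi0 3] *)

Lemma sigma11_or (X : topologicalType) (P Q : X -> Prop) :
  Sigma11 [set x | P x] -> Sigma11 [set x | Q x] -> Sigma11 [set x | P x \/ Q x].
Proof.
move=> SP SQ; have -> : [set x | P x \/ Q x] =
    [set x | exists n : nat, (if n is 0 then P else Q) x].
  apply/seteqP; split=> x; first by case; [exists 0%N|exists 1%N].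
  by case=> -[|n]; [left|right].
by apply: sigma11_exists => -[|n].
Qed.

Lemma sigma11_and (X : topologicalType) (P Q : X -> Prop) :
  Sigma11 [set x | P x] -> Sigma11 [set x | Q x] -> Sigma11 [set x | P x /\ Q x].
Proof.
move=> SP SQ; have -> : [set x | P x /\ Q x] =
    [set x | forall n : nat, (if n is 0 then P else Q) x].
  apply/seteqP; split=> x; first by move=> [Px Qx] [|n].
  by move=> PQ; split; [exact: (PQ 0%N)|exact: (PQ 1%N)].
by apply: sigma11_forall => -[|n].
Qed.

(** Normal form: unfolding three levels of the hierarchy shows that these are the countable
    intersections of countable unions of closed sets. *)
Lemma pi03P (X : topologicalType) (A : set X) :
  Pi0 3 A <-> exists2 P : nat -> nat -> set X,
    (forall m n, closed (P m n)) & forall x, A x <-> forall m, exists n, P m n x.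
Proof.
split=> [[F [SF AF]]|[P cP AP]].
  have /choice[P PF] m : exists P : nat -> set X,
      (forall n, closed (P n)) /\ ~` F m = \bigcup_n P n.
    have [P [oP ->]] := SF m; exists P; split=> // n.
    by rewrite -openC; exact: oP.
  exists P => [m n|x]; first exact: (PF m).1.
  rewrite -[A]setCK AF setC_bigcup; split=> [Fx m|Px m _].
    by have := Fx m Logic.I; rewrite (PF m).2 => -[n _]; exists n.
  by rewrite (PF m).2; have [n] := Px m; exists n.
exists (fun m => ~` \bigcup_n P m n); split=> [m|].
  by exists (P m); split=> [n|]; rewrite /= ?openC ?setCK.
rewrite -setC_bigcap; congr (~` _); apply/seteqP; split=> x.
  by move=> /AP Ax m _; have [n] := Ax m; exists n.
by move=> Px; apply/AP => m; have [n _] := Px m Logic.I; exists n.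
Qed.

Lemma pi03_forall_exists (X : topologicalType) (P : nat -> nat -> X -> Prop) :
  (forall m n, closed [set x | P m n x]) -> Pi0 3 [set x | forall m, exists n, P m n x].
Proof. by move=> cP; apply/pi03P; exists (fun m n => [set x | P m n x]). Qed.

Lemma pi03_closed (X : topologicalType) (A : set X) : closed A -> Pi0 3 A.
Proof.
move=> cA; apply/pi03P; exists (fun _ _ => A) => // x.
by split=> [Ax _|/(_ 0)[]//]; exists 0%N.
Qed.

Lemma pi03_forall (X : topologicalType) (P : nat -> X -> Prop) :
  (forall n, Pi0 3 [set x | P n x]) -> Pi0 3 [set x | forall n, P n x].
Proof.
move=> SP; have /choice[F PF] n : exists F : nat -> nat -> set X,
    (forall i j, closed (F i j)) /\ forall x, P n x <-> forall i, exists j, F i j x.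
  by have /pi03P[F cF FE] := SP n; exists F.
apply/pi03P.
(* The two universal quantifiers are merged by coding pairs; a number that codes no pair imposes the
   trivial condition [setT]. *)
exists (fun m k => if unpickle m is Some (n, i) then F n i k else setT) => [m k|x].
  by case: unpickle => [[n i]|]; [exact: (PF n).1 | exact: closedT].
split=> [Px m|Px n].
  case: unpickle => [[n i]|]; last by exists 0%N.
  exact: ((PF n).2 x).1.
by apply/(PF n).2 => i; have := Px (pickle (n, i)); rewrite pickleK.
Qed.

Lemma pi03_and (X : topologicalType) (P Q : X -> Prop) :
  Pi0 3 [set x | P x] -> Pi0 3 [set x | Q x] -> Pi0 3 [set x | P x /\ Q x].
Proof.
move=> SP SQ; have -> : [set x | P x /\ Q x] =
    [set x | forall n : nat, (if n is 0 then P else Q) x].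
  apply/seteqP; split=> x; first by move=> [Px Qx] [|n].
  by move=> PQ; split; [exact: (PQ 0%N)|exact: (PQ 1%N)].
by apply: pi03_forall => -[|n].
Qed.

Lemma pi03_sigma11 (X : topologicalType) (A : set X) : Pi0 3 A -> Sigma11 A.
Proof.
move=> /pi03P[P cP AP].
have -> : A = [set x | forall m, exists n, P m n x] by apply/seteqP; split=> x Ax; apply/AP.
by apply: sigma11_forall => m; apply: sigma11_exists => n; exact: sigma11_closed (cP m n).
Qed.

Lemma invSn_gt0 (R : realType) (n : nat) : 0 < n.+1%:R^-1 :> R.
Proof. by rewrite invr_gt0 ltr0n. Qed.

Lemma invSn_small (R : realType) (e : R) : 0 < e -> exists n, n.+1%:R^-1 < e.
Proof.
move=> e0; have [n _ /(_ n (leqnn n)) /= ne] := near_infty_natSinv_lt (PosNum e0).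
by exists n.
Qed.

Lemma pi03_lt (R : realType) (X : topologicalType) (a b : X -> R) :
  continuous a -> continuous b -> Pi0 3 [set x | a x < b x].
Proof.
(* A strict inequality holds iff it holds weakly with some margin [n.+1%:R^-1], a union of closed
   sets; the constant quantifier over [m] pads this to the normal form. *)
move=> ac bc; have -> : [set x | a x < b x] =
    [set x | forall m : nat, exists n : nat, a x + n.+1%:R^-1 <= b x].
  apply/seteqP; split=> x /= => [|/(_ 0)[n]]; last first.
    by apply: lt_le_trans; rewrite ltrDl invSn_gt0.
  rewrite -subr_gt0 => /invSn_small[n nab] _; exists n.
  by rewrite -lerBrDl ltW.
apply: pi03_forall_exists => _ n; apply: closed_le_continuous => //.
by continuity.
Qed.
(** A premise that does not vary with the point either leaves the condition as it is or makes it
    trivial, so it preserves every class containing the whole space. *)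
Lemma set_impliesE (X : Type) (P : Prop) (Q : X -> Prop) :
  [set x | P -> Q x] = if asbool P then [set x | Q x] else setT.
Proof.
case: asboolP => p; apply/seteqP; split=> x /=; tauto.
Qed.

Lemma closed_implies (X : topologicalType) (P : Prop) (Q : X -> Prop) :
  closed [set x | Q x] -> closed [set x | P -> Q x].
Proof. by move=> cQ; rewrite set_impliesE; case: asbool => //; exact: closedT. Qed.

Lemma pi03_implies (X : topologicalType) (P : Prop) (Q : X -> Prop) :
  Pi0 3 [set x | Q x] -> Pi0 3 [set x | P -> Q x].
Proof.
move=> SQ; rewrite set_impliesE; case: asbool => //.
by apply: pi03_closed; exact: closedT.
Qed.

Lemma closed_cst (X : topologicalType) (P : Prop) : closed [set _ : X | P].
Proof.
(* Writing [P] as [~ P -> False] reduces the claim to closedness of the empty set. *)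
rewrite (_ : mkset _ = [set _ | ~ P -> False]); last first.
  by apply/seteqP; split=> x /=; [tauto | exact: contrapT].
by apply: closed_implies; exact: closed0.
Qed.

Lemma closed_forall (X : topologicalType) (I : Type) (Q : I -> X -> Prop) :
  (forall i, closed [set x | Q i x]) -> closed [set x | forall i, Q i x].
Proof.
move=> cQ; rewrite (_ : mkset _ = \bigcap_i [set x | Q i x]); first exact: closed_bigI.
by apply/seteqP; split=> x Qx i; [move=> _; exact: Qx | exact: Qx].
Qed.

(** * Complexity of metrics, Cauchy sequences, continuity and [cdi_le] *)

Section Complexity.
Context {R : realType}.

(** Prenex form with each clause an inequality: vanishing exactly on the diagonal splits into a weak
    inequality on it and a strict one off it, and symmetry needs one direction for all pairs. *)
Lemma is_metricE (d : nat * nat -> R) : is_metric d <->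
  forall x y z, 0 <= d (x, y) /\ d (x, x) <= 0 /\ (x <> y -> 0 < d (x, y)) /\
    d (x, y) <= d (y, x) /\ d (x, z) <= d (x, y) + d (y, z).
Proof.
split=> [[d0 [dE [dC dD]]] x y z|dP].
  split=> //; split; [|split; [|split=> //; last by rewrite dC]].
    by have /dE -> := erefl x.
  by move=> xy; rewrite lt_neqAle d0 andbT; apply/eqP => /esym/dE.
have d0 x y : 0 <= d (x, y) by have [] := dP x y x.
split=> //; split.
  move=> x y; split=> [dxy|->].
    case: (eqVneq x y) => // /eqP xy.
    by have [_ [_ [/(_ xy)]]] := dP x y x; rewrite dxy ltxx.
  by apply/eqP; rewrite eq_le d0 andbT; have [_ []] := dP y y y.
split=> [x y|x y z]; last by have [_ [_ [_ []]]] := dP x y z.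
apply/eqP; rewrite eq_le; have [_ [_ [_ [-> _]]]] := dP x y x.
by have [_ [_ [_ [-> _]]]] := dP y x y.
Qed.

(** Analytic sets are not closed under complement, so the negation gets its own form with countable
    quantifiers and inequalities. *)
Lemma not_is_metricE (d : nat * nat -> R) : ~ is_metric d <->
  exists x y z, d (x, y) < 0 \/ 0 < d (x, x) \/ (x <> y /\ d (x, y) <= 0) \/
    d (y, x) < d (x, y) \/ d (x, y) + d (y, z) < d (x, z).
Proof.
rewrite is_metricE; split=> [|[x [y [z dN]]] /(_ x y z)[d0 [dxx [dxy [dC dD]]]]].
  move=> /existsNP[x /existsNP[y /existsNP[z dN]]]; exists x, y, z; apply: contrapT => dP.
  apply: dN; split; [|split; [|split; [|split]]];
    try by rewrite leNgt; apply/negP => ?; apply: dP; tauto.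
  by move=> xy; rewrite ltNge; apply/negP => ?; apply: dP; tauto.
case: dN => [|[|[[/dxy]|[|]]]]; rewrite ltNge ?d0 ?dxx ?dC ?dD //.
by move=> /negP.
Qed.

(** Tolerances of the form [k.+1%:R^-1] make the quantifier countable, and the weak inequality makes
    the innermost condition closed. *)
Lemma cauchy_seqE (d : nat * nat -> R) (z : nat -> nat) : cauchy_seq d z <->
  forall k, exists N, forall m n, (N <= m)%N -> (N <= n)%N -> d (z m, z n) <= k.+1%:R^-1.
Proof.
split=> [cz k|cz e e0].
  have [N zN] := cz _ (invSn_gt0 R k).
  by exists N => m n Nm Nn; apply: ltW; exact: zN.
have [k ke] := invSn_small R e e0; have [N zN] := cz k.
by exists N => m n Nm Nn; apply: le_lt_trans ke; exact: zN.
Qed.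

(** Here the implication between strict inequalities becomes a disjunction of weak ones, closed for
    each [y]. *)
Lemma metric_continuousE (d d' : nat * nat -> R) (g : nat -> nat) :
  metric_continuous d d' g <-> forall x k, exists l, forall y,
    l.+1%:R^-1 <= d (x, y) \/ d' (g x, g y) <= k.+1%:R^-1.
Proof.
split=> [gc x k|gc x e e0].
  have [e e0 ge] := gc x _ (invSn_gt0 R k); have [l le] := invSn_small R e e0.
  exists l => y; case: (leP l.+1%:R^-1 (d (x, y))) => xy; first by left.
  by right; apply/ltW/ge; exact: lt_trans le.
have [k ke] := invSn_small R e e0; have [l gl] := gc x k.
exists l.+1%:R^-1; first exact: invSn_gt0.
move=> y xy; have [|] := gl y; first by rewrite leNgt xy.
by move=> /le_lt_trans; apply.
Qed.

Lemma dense_isometryE (d0 d1 : nat * nat -> R) (i : nat -> nat) :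
  dense_isometry d0 d1 i <->
  (forall x y, d1 (i x, i y) <= d0 (x, y) /\ d0 (x, y) <= d1 (i x, i y)) /\
  (forall y k, exists x, d1 (i x, y) <= k.+1%:R^-1).
Proof.
split=> -[iso dense]; [split=> [x y|y k]|split=> [x y|y e e0]]; first by rewrite iso lexx.
- by have [x xy] := dense y _ (invSn_gt0 R k); exists x; exact: ltW.
- by apply/eqP; rewrite eq_le; apply/andP; exact: iso.
have [k ke] := invSn_small R e e0; have [x xy] := dense y k.
by exists x; exact: le_lt_trans ke.
Qed.

Lemma pi03_is_metric (X : topologicalType) (d : X -> RMat R) :
  continuous d -> Pi0 3 [set x | is_metric (d x)].
Proof.
move=> dc; under eq_set do rewrite (propext (is_metricE _)).
apply: pi03_forall => a; apply: pi03_forall => b; apply: pi03_forall => c.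
apply: pi03_and; first by apply/pi03_closed/closed_le_continuous; continuity.
apply: pi03_and; first by apply/pi03_closed/closed_le_continuous; continuity.
apply: pi03_and; first by apply/pi03_implies/pi03_lt; continuity.
by apply: pi03_and; apply/pi03_closed/closed_le_continuous; continuity.
Qed.

Lemma sigma11_not_is_metric (X : topologicalType) (d : X -> RMat R) :
  continuous d -> Sigma11 [set x | ~ is_metric (d x)].
Proof.
move=> dc; under eq_set do rewrite (propext (not_is_metricE _)).
apply: sigma11_exists => a; apply: sigma11_exists => b; apply: sigma11_exists => c.
apply: sigma11_or; first by apply/pi03_sigma11/pi03_lt; continuity.
apply: sigma11_or; first by apply/pi03_sigma11/pi03_lt; continuity.
apply: sigma11_or.
  apply: sigma11_and; last by apply/sigma11_closed/closed_le_continuous; continuity.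
  by apply: sigma11_closed; apply: closed_cst.
by apply: sigma11_or; apply/pi03_sigma11/pi03_lt; continuity.
Qed.

Lemma pi03_cauchy_seq (X : topologicalType) (d : X -> RMat R) (z : X -> BaireSp) :
  continuous d -> continuous z -> Pi0 3 [set x | cauchy_seq (d x) (z x)].
Proof.
move=> dc zc; under eq_set do rewrite (propext (cauchy_seqE _ _)).
apply: pi03_forall_exists => k N; apply: closed_forall => m; apply: closed_forall => n.
by do 2!apply: closed_implies; apply: closed_le_continuous; continuity.
Qed.

Lemma sigma11_not_cauchy_seq (X : topologicalType) (d : X -> RMat R) (z : X -> BaireSp) :
  continuous d -> continuous z -> Sigma11 [set x | ~ cauchy_seq (d x) (z x)].
Proof.
(* If some tolerance fails, so does a smaller one [k.+1%:R^-1], and its failure is a weak inequality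
   at arbitrarily late indices. *)
move=> dc zc; rewrite (_ : mkset _ = [set x | exists k, forall N, exists m n,
    ((N <= m)%N /\ (N <= n)%N) /\ k.+1%:R^-1 <= d x (z x m, z x n)]).
  apply: sigma11_exists => k; apply: sigma11_forall => N.
  apply: sigma11_exists => m; apply: sigma11_exists => n; apply: sigma11_and.
    by apply: sigma11_closed; apply: closed_cst.
  by apply/sigma11_closed/closed_le_continuous; continuity.
apply/seteqP; split=> x /=.
  move=> zN; apply: contrapT => zP; apply: zN => e /invSn_small[k ke].
  apply: contrapT => zN; apply: zP; exists k => N; apply: contrapT => zP.
  apply: zN; exists N => m n Nm Nn; apply: lt_trans ke; rewrite ltNge; apply/negP => ?.
  by apply: zP; exists m, n.
move=> [k kP] /(_ _ (invSn_gt0 R k))[N NP]; have [m [n [[Nm Nn]]]] := kP N.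
by rewrite leNgt NP.
Qed.

Lemma pi03_metric_continuous (X : topologicalType) (d d' : X -> RMat R) (g : X -> BaireSp) :
  continuous d -> continuous d' -> continuous g ->
  Pi0 3 [set x | metric_continuous (d x) (d' x) (g x)].
Proof.
move=> dc dc' gc; under eq_set do rewrite (propext (metric_continuousE _ _ _)).
apply: pi03_forall => x; apply: pi03_forall_exists => k l; apply: closed_forall => y.
by apply: closedU; apply: closed_le_continuous; continuity.
Qed.

Lemma sigma11_dense_isometry (X : topologicalType) (d0 d1 : X -> RMat R) (i : X -> BaireSp) :
  continuous d0 -> continuous d1 -> continuous i ->
  Sigma11 [set x | dense_isometry (d0 x) (d1 x) (i x)].
Proof.
move=> d0c d1c ic; under eq_set do rewrite (propext (dense_isometryE _ _ _)).
apply: sigma11_and.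
  apply: sigma11_forall => x; apply: sigma11_forall => y.
  by apply: sigma11_and; apply/sigma11_closed/closed_le_continuous; continuity.
apply: sigma11_forall => y; apply: sigma11_forall => k; apply: sigma11_exists => x.
by apply/sigma11_closed/closed_le_continuous; continuity.
Qed.

Lemma closed_commuting_square (X : topologicalType) (f g h k : X -> BaireSp) :
  continuous f -> continuous g -> continuous h -> continuous k ->
  closed [set x | f x \o g x = h x \o k x].
Proof.
move=> fc gc hc kc.
rewrite (_ : mkset _ = [set x | forall n, f x (g x n) = h x (k x n)]).
  by apply: closed_forall => n; apply: (@closed_eq_discrete _ nat); continuity.
apply/seteqP; split=> x /= fE; last exact: funext.
by move=> n; exact: (congr1 (@^~ n) fE).
Qed.

Lemma sigma11_cdi_le (X : topologicalType) (g0 g1 : X -> BaireSp)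
    (d0 d0' d1 d1' : X -> RMat R) :
  continuous g0 -> continuous d0 -> continuous d0' ->
  continuous g1 -> continuous d1 -> continuous d1' ->
  Sigma11 [set x | cdi_le (g0 x) (d0 x) (d0' x) (g1 x) (d1 x) (d1' x)].
Proof.
move=> g0c d0c d0c' g1c d1c d1c'.
(* The two projections are along [iota] and [iota']; only countable quantifiers over closed
   conditions remain. *)
apply: sigma11_exists_baire; apply: sigma11_exists_baire.
rewrite (_ : mkset _ = [set q : X * BaireSp * BaireSp |
  dense_isometry (d0 q.1.1) (d1 q.1.1) q.1.2 /\
  dense_isometry (d0' q.1.1) (d1' q.1.1) q.2 /\
  (q.2 : nat -> nat) \o g0 q.1.1 = g1 q.1.1 \o (q.1.2 : nat -> nat)]).
  apply: sigma11_and; first by apply: sigma11_dense_isometry; continuity.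
  apply: sigma11_and; first by apply: sigma11_dense_isometry; continuity.
  by apply: sigma11_closed; apply: closed_commuting_square; continuity.
by apply/seteqP; split=> q /=; [case | case=> ? []].
Qed.

(** Failure of Cauchy-continuity is witnessed by one Cauchy sequence whose image is not Cauchy,
    hence by a single projection along Baire space. *)
Lemma sigma11_not_Comega (X : topologicalType) (g : X -> BaireSp) (d d' : X -> RMat R) :
  continuous g -> continuous d -> continuous d' ->
  Sigma11 [set x | ~ Comega (g x) (d x) (d' x)].
Proof.
move=> gc dc dc'; rewrite (_ : mkset _ = [set x | ~ is_metric (d x) \/ ~ is_metric (d' x) \/
    exists z : BaireSp, cauchy_seq (d x) z /\ ~ cauchy_seq (d' x) (g x \o z)]).
  apply: sigma11_or; first exact: sigma11_not_is_metric.
  apply: sigma11_or; first exact: sigma11_not_is_metric.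
  apply: sigma11_exists_baire; apply: sigma11_and.
    by apply/pi03_sigma11/pi03_cauchy_seq; continuity.
  apply: sigma11_not_cauchy_seq; first by continuity.
  apply: (continuous_baire_comp _ (fun q : X * BaireSp => g q.1) snd); continuity.
apply/seteqP; split=> x /=.
  move=> CN; apply: contrapT => /not_orP[/contrapT dm /not_orP[/contrapT dm' zN]].
  apply: CN; split=> //; split=> // z cz; apply: contrapT => cN.
  by apply: zN; exists z.
by move=> [dN|[dN|[z [cz zN]]]] [? [? gP]] //; apply: zN; exact: gP.
Qed.

End Complexity.

(** * Continuity versus Cauchy-continuity, and the complexity of [cdi_equiv] *)

Section CauchyContinuity.
Context {R : realType}.

Lemma cauchy_seq_close (d : nat * nat -> R) (u v : nat -> nat) :
  is_metric d -> (forall n, d (u n, v n) < n.+1%:R^-1) ->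
  cauchy_seq d u -> cauchy_seq d v.
Proof.
move=> [_ [_ [dC dD]]] uv cu e e0; have e3 : 0 < e / 3 by rewrite divr_gt0.
have [k ke] := invSn_small R _ e3; have [N uN] := cu _ e3.
have small n : (k <= n)%N -> d (u n, v n) < e / 3.
  move=> kn; apply: lt_trans (uv n) _; apply: le_lt_trans ke.
  by rewrite lef_pV2 ?posrE ?ltr0n // ler_nat.
exists (maxn k N) => m n; rewrite !geq_max => /andP[km Nm] /andP[kn Nn].
have := dD (v m) (u m) (v n); have := dD (u m) (u n) (v n).
by rewrite (dC (v m) (u m)); have := small m km; have := small n kn; have := uN m n Nm Nn; lra.
Qed.

(** If continuity fails at [x], points [y n] tend to [x] while their images stay away from [g x].
    Interleaving them with [x] gives a Cauchy sequence whose image is not Cauchy. *)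
Lemma cauchy_continuous_continuous (d d' : nat * nat -> R) (g : nat -> nat) :
  is_metric d -> cauchy_continuous d d' g -> metric_continuous d d' g.
Proof.
move=> dm gc x e e0; apply: contrapT => gN.
have /choice[y yP] n : exists y, d (x, y) < n.+1%:R^-1 /\ ~ d' (g x, g y) < e.
  apply: contrapT => yN; apply: gN; exists n.+1%:R^-1; first exact: invSn_gt0.
  by move=> y xy; apply: contrapT => ge; apply: yN; exists y.
have dxx : d (x, x) = 0 by apply/(dm.2.1 x x).
have /gc/(_ _ e0)[N zN] : cauchy_seq d (fun n => if odd n then y n else x).
  apply: (@cauchy_seq_close d (fun=> x)) => // [n|r r0].
    by case: odd; [have [] := yP n | rewrite dxx invSn_gt0].
  by exists 0%N => *; rewrite dxx.
(* Positions [N.*2] and [N.*2.+1] are past [N]; the even one carries [x], the odd one a point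
   [y]. *)
have NN : (N <= N.*2)%N by rewrite -addnn leq_addr.
apply: (yP N.*2.+1).2; have := zN N.*2 N.*2.+1 NN (leqW NN).
by rewrite /= odd_double.
Qed.

(** The approximating sequence in the range of [i] is pulled back to [d0], mapped by [g0], and
    pushed forward by [i']; the commuting square identifies the result with its image under [g]. *)
Lemma cdi_le_cauchy_continuous (g0 g : nat -> nat) (d0 d0' d d' : nat * nat -> R) :
  is_metric d -> is_metric d' -> cauchy_continuous d0 d0' g0 ->
  metric_continuous d d' g -> cdi_le g0 d0 d0' g d d' -> cauchy_continuous d d' g.
Proof.
move=> dm dm' g0c gc [i [i' [[iso dense] [iso' _] ig]]] z zc.
have /choice[x xP] n : exists x, d (i x, z n) < n.+1%:R^-1 /\
    d' (g (i x), g (z n)) < n.+1%:R^-1.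
  have [e e0 ge] := gc (z n) _ (invSn_gt0 R n).
  (* The minimum keeps [i x] both within [n.+1%:R^-1] of [z n] and within the radius that continuity
     of [g] at [z n] provides. *)
  have [|x] := dense (z n) (Num.min e n.+1%:R^-1); first by rewrite lt_min e0 invSn_gt0.
  rewrite lt_min => /andP[xe xn]; exists x; split=> //.
  by rewrite dm'.2.2.1; apply: ge; rewrite dm.2.2.1.
have ixc : cauchy_seq d (i \o x).
  apply: (cauchy_seq_close _ _ _ dm _ zc) => n.
  by rewrite dm.2.2.1; exact: (xP n).1.
have xc : cauchy_seq d0 x.
  move=> e /ixc[N xN]; exists N => m n Nm Nn.
  by rewrite -iso; exact: xN.
apply: (@cauchy_seq_close d' (g \o i \o x)) => // [n|]; first exact: (xP n).2.
move=> e /(g0c _ xc)[N xN]; exists N => m n Nm Nn.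
by rewrite -ig /= iso'; exact: xN.
Qed.

(** Moves Cauchy-continuity out of the scope of the existential quantifiers: on the right every
    condition on [g], [d], [d'] is analytic. *)
Lemma cdi_equivE (g0 g1 : nat -> nat) (d0 d0' d1 d1' : nat * nat -> R) :
  Comega g0 d0 d0' -> cdi_equiv g0 d0 d0' g1 d1 d1' <->
  exists (g : BaireSp) (d d' : RMat R),
    [/\ is_metric d, is_metric d' & metric_continuous d d' g] /\
    cdi_le g0 d0 d0' g d d' /\ cdi_le g1 d1 d1' g d d'.
Proof.
move=> [_ [_ g0c]]; split=> [[g [d [d' [[dm [dm' gc]] le0 le1]]]]|].
  by exists g, d, d'; do !split=> //; exact: cauchy_continuous_continuous.
move=> [g [d [d' [[dm dm' gc] [le0 le1]]]]]; exists g, d, d'; split=> //.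
by split=> //; split=> //; exact: (cdi_le_cauchy_continuous _ _ _ _ _ _ dm dm' g0c gc le0).
Qed.

Lemma pi03_continuous_metric_triple (X : topologicalType) (g : X -> BaireSp)
    (d d' : X -> RMat R) :
  continuous g -> continuous d -> continuous d' ->
  Pi0 3 [set x | [/\ is_metric (d x), is_metric (d' x)
                   & metric_continuous (d x) (d' x) (g x)]].
Proof.
move=> gc dc dc'; rewrite (_ : mkset _ = [set x | is_metric (d x) /\ is_metric (d' x) /\
    metric_continuous (d x) (d' x) (g x)]); last first.
  by apply/seteqP; split=> x /=; [case | case=> ? []].
apply: pi03_and; first exact: pi03_is_metric.
by apply: pi03_and; [exact: pi03_is_metric | exact: pi03_metric_continuous].
Qed.

Lemma sigma11_cdi_equiv_continuous (X : topologicalType) (g0 g1 : X -> BaireSp)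
    (d0 d0' d1 d1' : X -> RMat R) :
  continuous g0 -> continuous d0 -> continuous d0' ->
  continuous g1 -> continuous d1 -> continuous d1' ->
  Sigma11 [set x | exists (g : BaireSp) (d d' : RMat R),
    [/\ is_metric d, is_metric d' & metric_continuous d d' g] /\
    cdi_le (g0 x) (d0 x) (d0' x) g d d' /\ cdi_le (g1 x) (d1 x) (d1' x) g d d'].
Proof.
move=> g0c d0c d0c' g1c d1c d1c'.
apply: sigma11_exists_baire; do 2!apply: sigma11_exists_matrix.
apply: sigma11_and; first by apply/pi03_sigma11/pi03_continuous_metric_triple; continuity.
by apply: sigma11_and; apply: sigma11_cdi_le; continuity.
Qed.

End CauchyContinuity.
Theorem theorem4p6 (R : realType) :
  (* (a) *)
  Pi0 3 [set p : (BaireSp * RMat R)%type |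
           is_metric p.2 /\ cauchy_seq p.2 p.1] /\
  (* (b) *)
  Pi0 3 [set p : (BaireSp * (RMat R * RMat R))%type |
           [/\ is_metric p.2.1, is_metric p.2.2
             & metric_continuous p.2.1 p.2.2 p.1]] /\
  (* (c) *)
  Pi11 [set p : (BaireSp * (RMat R * RMat R))%type |
          Comega p.1 p.2.1 p.2.2] /\
  (* (d) *)
  (exists A B : set ((BaireSp * BaireSp) *
                     (((RMat R * RMat R) * (RMat R * RMat R))))%type,
     [/\ Sigma11 A, Pi11 B &
       [set p | let: ((g0, g1), ((d0, d0'), (d1, d1'))) := p in
          [/\ Comega g0 d0 d0', Comega g1 d1 d1'
            & cdi_le g0 d0 d0' g1 d1 d1']] = A `&` B]) /\
  (* (e) *)
  (exists A B : set ((BaireSp * BaireSp) *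
                     (((RMat R * RMat R) * (RMat R * RMat R))))%type,
     [/\ Sigma11 A, Pi11 B &
       [set p | let: ((g0, g1), ((d0, d0'), (d1, d1'))) := p in
          [/\ Comega g0 d0 d0', Comega g1 d1 d1'
            & cdi_equiv g0 d0 d0' g1 d1 d1']] = A `&` B]).
Proof.
pose Y : topologicalType := (BaireSp * RMat R)%type.
have zc : continuous (fst : Y -> BaireSp) by exact: continuous_fst.
have mc : continuous (snd : Y -> RMat R) by exact: continuous_snd.
pose Z : topologicalType := (BaireSp * (RMat R * RMat R))%type.
have gc : continuous (fst : Z -> BaireSp) by exact: continuous_fst.
have dc : continuous (fst \o snd : Z -> RMat R) by rewrite /comp; continuity.
have dc' : continuous (snd \o snd : Z -> RMat R) by rewrite /comp; continuity.
pose X : topologicalType := ((BaireSp * BaireSp) *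
  ((RMat R * RMat R) * (RMat R * RMat R)))%type.
pose g0 : X -> BaireSp := fst \o fst.
pose g1 : X -> BaireSp := snd \o fst.
pose d0 : X -> RMat R := fst \o (fst \o snd).
pose d0' : X -> RMat R := snd \o (fst \o snd).
pose d1 : X -> RMat R := fst \o (snd \o snd).
pose d1' : X -> RMat R := snd \o (snd \o snd).
have [g0c g1c] : continuous g0 /\ continuous g1 by split; rewrite /g0 /g1 /comp; continuity.
have [d0c d0c'] : continuous d0 /\ continuous d0' by split; rewrite /d0 /d0' /comp; continuity.
have [d1c d1c'] : continuous d1 /\ continuous d1' by split; rewrite /d1 /d1' /comp; continuity.
(* Membership of both triples in the domain is the co-analytic factor, shared by the last two
   claims. *)
pose B : set X := [set p | Comega (g0 p) (d0 p) (d0' p) /\ Comega (g1 p) (d1 p) (d1' p)].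
have PB : Pi11 B.
  rewrite /Pi11 (_ : ~` B = [set p | ~ Comega (g0 p) (d0 p) (d0' p) \/
                                     ~ Comega (g1 p) (d1 p) (d1' p)]).
    by apply: sigma11_or; exact: sigma11_not_Comega.
  by apply/seteqP; split=> p /not_andP.
split; [|split; [|split; [|split]]].
- exact: (pi03_and _ _ _ (pi03_is_metric _ _ mc) (pi03_cauchy_seq _ _ _ mc zc)).
- exact: (pi03_continuous_metric_triple _ _ _ _ gc dc dc').
- exact: (sigma11_not_Comega _ _ _ _ gc dc dc').
- exists [set p | cdi_le (g0 p) (d0 p) (d0' p) (g1 p) (d1 p) (d1' p)], B.
  split=> //; first exact: sigma11_cdi_le.
  by apply/seteqP; split=> -[[? ?] [[? ?] [? ?]]] /=; [case | case=> ? []].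
(* The analytic factor asks only for a continuous [g]; inside [B] the first triple is
   Cauchy-continuous, so [cdi_equivE] identifies this with [cdi_equiv]. *)
exists [set p | exists (g : BaireSp) (d d' : RMat R),
    [/\ is_metric d, is_metric d' & metric_continuous d d' g] /\
    cdi_le (g0 p) (d0 p) (d0' p) g d d' /\ cdi_le (g1 p) (d1 p) (d1' p) g d d'], B.
split=> //; first exact: sigma11_cdi_equiv_continuous.
apply/seteqP; split=> -[[a0 a1] [[e0 e0'] [e1 e1']]] /=.
  by move=> [C0 C1 /(cdi_equivE _ _ _ _ _ _ C0)].
by move=> [E [C0 C1]]; split=> //; apply/(cdi_equivE _ _ _ _ _ _ C0).
Qed.
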